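(* Let $f$, $E$ be the exact solution of the (Galerkin formulation of the) 1D-1V Vlasov-Poisson problem and let $f^N$, $E^N$ be the approximations solving the truncated Vlasov-Poisson problem, with velocity domain $\Omega_v=]v_{\min},v_{\max}[$ and $\Omega=\Omega_x\times\Omega_v$. Then there is a constant $C$, independent of $N$, such that for every $t\in[0,T[$ $$\|E(\cdot,t)-E^N(\cdot,t)\|_{L^2(\Omega_x)}\le C\,|\Omega_v|^{1/2}\,\|f(\cdot,\cdot,t)-f^N(\cdot,\cdot,t)\|_{L^2(\Omega)}.$$
   Context: $\Omega_x=[0,2\pi[$, $\Omega_v=]v_{\min},v_{\max}[$ (a finite velocity domain is also taken for the Hermite-Fourier method), $|\Omega_v|=v_{\max}-v_{\min}$, $T$ finite. Distribution functions and electric fields are real-valued. Continuous problem: $\partial_tf+v\,\partial_xf-E\,\partial_vf=0$ and $\partial_xE=\rho:=1-\int_{\Omega_v}f\,dv$, $t\in[0,T[$, with $f(\cdot,\cdot,0)=f_0$, periodic in $x$, and $f=0$ at $v=v_{\min},v_{\max}$. Its Galerkin formulation requires $\int_\Omega\varphi_n\eta_k(\partial_tf+v\partial_xf-E\partial_vf)\,dv\,dx=0$ for all $n\ge0$, $k\in\mathbb{Z}$ and $\int_{\Omega_x}\partial_xE\,\eta_k\,dx=\int_{\Omega_x}\rho\,\eta_k\,dx$ for all $k\in\mathbb{Z}$. Bases: $\eta_k(x)=\frac{1}{\sqrt{2\pi}}e^{ikx}$. $\{\varphi_n\}_{n\ge0}$ is either (Legendre-Fourier) the Legendre polynomials mapped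 affinely to $[v_{\min},v_{\max}]$ and normalized, or (Hermite-Fourier) the symmetrically weighted Hermite functions (suitably normalized Hermite polynomials times $e^{-v^2/2}$); they are taken to satisfy $\int_{\Omega_v}\varphi_n\varphi_{n'}\,dv=\delta_{n,n'}$. Truncated problem: for positive integers $N_S,N_F$ and $N=(N_S,N_F)$, $\mathcal{F}^N=\mathrm{span}\{\eta_k\}_{|k|\le N_F}$, $\mathcal{X}^N=\mathrm{span}\{\eta_k\varphi_n\}_{|k|\le N_F,\,0\le n\le N_S-1}$; $\mathcal{P}^N_F$ and $\mathcal{P}^N$ are the $L^2$-orthogonal projections onto $\mathcal{F}^N$ (in $x$) and onto $\mathcal{X}^N$. Find $f^N(\cdot,\cdot,t)\in\mathcal{X}^N$, $E^N(\cdot,t)\in\mathcal{F}^N$ with $$\mathcal{P}^N(\partial_tf^N+v\partial_xf^N-E^N\partial_vf^N)=R^N,\quad \mathcal{P}^N_F(\partial_xE^N-\rho^N)=0,\quad \rho^N=1-\int_{\Omega_v}f^N\,dv,\quad f^N(\cdot,\cdot,0)=\mathcal{P}^Nf_0,$$ $$R^N(x,v,t)=-\tfrac12\mathcal{P}^N\Big(E^N(x,t)\Big[f^N(x,v_{\max},t)\sum_{n=0}^{N_S-1}\varphi_n(v_{\max})\varphi_n(v)-f^N(x,v_{\min},t)\sum_{n=0}^{N_S-1}\varphi_n(v_{\min})\varphi_n(v)\Big]\Big).$$ Normalization: the electric fields have zero mean, so $E_0=E^N_0=0$, and for $k\ne0$ the Fourier coefficients with respect to $\eta_k$ are $E_k(t)=\frac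 ik\int_\Omega f\,\eta_{-k}\,dx\,dv$ and, for $0<|k|\le N_F$, $E^N_k(t)=\frac ik\int_\Omega f^N\eta_{-k}\,dx\,dv$. *)

(* Defs.v *)
From HB Require Import structures.
From mathcomp Require Import all_boot all_order all_algebra.
From mathcomp Require Import all_classical all_reals all_analysis.
From mathcomp Require Import complex.

Set Implicit Arguments.
Unset Strict Implicit.
Unset Printing Implicit Defensive.

Import Order.TTheory GRing.Theory Num.Theory.
Import numFieldNormedType.Exports.

Local Open Scope classical_set_scope.
Local Open Scope ring_scope.
Local Open Scope complex_scope.

Section LebesgueTools.
Context {d : measure_display} {T : measurableType d} {R : realType}.
Variables (mu : {measure set T -> \bar R}) (D : set T).

(* The integral of a complex-valued function, taken componentwise. *)
Definition cintegral (g : T -> R[i]) : R[i] :=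
  (\int[mu]_(z in D) complex.Re (g z)) +i* (\int[mu]_(z in D) complex.Im (g z)).

Definition l2norm (g : T -> R) : \bar R := 'N[mu]_2%:E[EFin \o (g \_ D)].

Definition in_l2 (g : T -> R) : Prop :=
  measurable_fun D g /\ (l2norm g < +oo)%E.

(* [p] is the L^2(D)-orthogonal projection of [g] onto the space [V]. *)
Definition is_orth_proj (V : set (T -> R[i])) (g p : T -> R[i]) : Prop :=
  V p /\ forall psi, V psi ->
    cintegral (fun z => (g z - p z) * conjc (psi z)) = 0.

End LebesgueTools.

Section Bases.
Variable R : realType.

Definition eta (k : int) (x : R) : R[i] :=
  (cos (k%:~R * x) / Num.sqrt (2 * pi)) +i*
  (sin (k%:~R * x) / Num.sqrt (2 * pi)).

(* Rodrigues' formula *)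
Definition legendre (n : nat) : {poly R} :=
  (2 ^+ n * n`!%:R)^-1 *: (('X^2 - 1) ^+ n)^`(n).

(* Physicists' convention: leading coefficient 2^n, weight exp(-v^2) *)
Fixpoint hermite (n : nat) : {poly R} :=
  if n is m.+1 then 2%:P * 'X * hermite m - (hermite m)^`() else 1.

Definition legendre_basis (vmin vmax : R) (phi : nat -> R -> R) : Prop :=
  forall n v, phi n v =
    Num.sqrt (n.*2.+1%:R / (vmax - vmin)) *
    (legendre n).[(2 * v - vmin - vmax) / (vmax - vmin)].

(* The Hermite functions are orthogonal on the whole line; on a bounded
   velocity domain no choice of the factors [c n] makes them exactly
   orthonormal, so these factors are left free. *)
Definition hermite_basis (phi : nat -> R -> R) : Prop :=
  exists c : nat -> R, forall n, c n != 0 /\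
    forall v, phi n v = c n * (hermite n).[v] * expR (- (v ^+ 2 / 2)).

Definition velocity_basis (vmin vmax : R) (phi : nat -> R -> R) : Prop :=
  legendre_basis vmin vmax phi \/ hermite_basis phi.

End Bases.

Section VlasovPoisson.
Variable R : realType.
Variables (vmin vmax T : R) (phi : nat -> R -> R).

(* Distribution functions are written [f x v t] and fields [E x t]; they are
   2 pi-periodic in x and only their values for v in [vmin, vmax] and
   t in [0, T[ are constrained. *)
Implicit Types (f : R -> R -> R -> R) (E : R -> R -> R).

Definition Omega_x : set (measurableTypeR R) := `[0, 2 * pi[.
Definition Omega_v : set (measurableTypeR R) := `]vmin, vmax[.
Definition Omega : set (measurableTypeR R * measurableTypeR R) :=
  Omega_x `*` Omega_v.

Definition leb1 : {measure set (measurableTypeR R) -> \bar R} :=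
  @lebesgue_measure R.
Definition leb2 :
  {measure set (measurableTypeR R * measurableTypeR R) -> \bar R} :=
  (@lebesgue_measure R \x @lebesgue_measure R)%E.

Definition in_time (t : R) : Prop := 0 <= t < T.

Definition vlasov f E (x v t : R) : R :=
  derive1 (f x v) t + v * derive1 (fun y => f y v t) x
  - E x t * derive1 (fun w => f x w t) v.

Definition charge_density f (x t : R) : R :=
  1 - \int[leb1]_(v in Omega_v) f x v t.

(* Coefficient with respect to [eta k]; conj (eta k) = eta (- k). *)
Definition fourier_coef E (k : int) (t : R) : R[i] :=
  cintegral leb1 Omega_x (fun x => (E x t)%:C * eta (- k) x).

(* Zero mean, and E_k = (i / k) int_Omega f eta_{-k} for k != 0, required for
   the wave numbers selected by [P]. *)
Definition normalized_field (P : pred int) f E (t : R) : Prop :=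
  fourier_coef E 0 t = 0 /\
  forall k : int, k != 0 -> P k ->
    fourier_coef E k t =
    'i / k%:~R *
    cintegral leb2 Omega (fun z => (f z.1 z.2 t)%:C * eta (- k) z.1).

Record exact_solution (f0 : R -> R -> R) f E : Prop := ExactSolution {
  exact_f_periodic : forall x v t, vmin <= v <= vmax -> in_time t ->
    f (x + 2 * pi) v t = f x v t;
  exact_E_periodic : forall x t, in_time t -> E (x + 2 * pi) t = E x t;
  exact_f_l2 : forall t, in_time t ->
    in_l2 leb2 Omega (fun z => f z.1 z.2 t);
  exact_f_cont_v : forall x t, in_time t ->
    {within `[vmin, vmax], continuous (fun v => f x v t)};
  exact_f_cont_t : forall x v, vmin <= v <= vmax ->
    {within `[0, T[, continuous (f x v)};
  exact_f_derivable : forall x v t, vmin < v < vmax -> 0 < t < T ->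
    [/\ derivable (f x v) t 1,
        derivable (fun y => f y v t) x 1 &
        derivable (fun w => f x w t) v 1];
  exact_E_derivable : forall x t, in_time t -> derivable (E^~ t) x 1;
  exact_vlasov_integrable : forall t, 0 < t < T ->
    leb2.-integrable Omega (fun z => (vlasov f E z.1 z.2 t)%:E);
  exact_dE_integrable : forall t, in_time t ->
    leb1.-integrable Omega_x (EFin \o derive1 (E^~ t));
  exact_vlasov : forall (n : nat) (k : int) t, 0 < t < T ->
    cintegral leb2 Omega (fun z =>
      (phi n z.2)%:C * eta k z.1 * (vlasov f E z.1 z.2 t)%:C) = 0;
  exact_poisson : forall (k : int) t, in_time t ->
    cintegral leb1 Omega_x (fun x => (derive1 (E^~ t) x)%:C * eta k x) =
    cintegral leb1 Omega_x (fun x => (charge_density f x t)%:C * eta k x);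
  exact_boundary : forall x t, in_time t ->
    f x vmin t = 0 /\ f x vmax t = 0;
  exact_initial : forall x v, vmin <= v <= vmax -> f x v 0 = f0 x v;
  exact_normalized : forall t, in_time t -> normalized_field predT f E t
}.

Section Truncated.
Variables (NS NF : nat).

(* The wave numbers -NF, ..., NF *)
Definition wave (j : 'I_(2 * NF).+1) : int := j%:Z - NF%:Z.

Definition space_F : set (measurableTypeR R -> R[i]) :=
  [set g | exists c : int -> R[i], forall x,
    g x = \sum_(j < (2 * NF).+1) c (wave j) * eta (wave j) x].

Definition space_X : set (measurableTypeR R * measurableTypeR R -> R[i]) :=
  [set g | exists c : int -> nat -> R[i], forall x v, vmin <= v <= vmax ->
    g (x, v) = \sum_(j < (2 * NF).+1) \sum_(n < NS)
      c (wave j) n * eta (wave j) x * (phi n v)%:C].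

Definition is_proj_F := is_orth_proj leb1 Omega_x space_F.
Definition is_proj_X := is_orth_proj leb2 Omega space_X.

Definition velocity_kernel (w v : R) : R := \sum_(n < NS) phi n w * phi n v.

(* [r] is R^N( . , . , t) for the given f and E. *)
Definition is_boundary_residual f E (t : R)
    (r : measurableTypeR R * measurableTypeR R -> R[i]) : Prop :=
  exists2 p, is_proj_X (fun z => (E z.1 t *
       (f z.1 vmax t * velocity_kernel vmax z.2
        - f z.1 vmin t * velocity_kernel vmin z.2))%:C) p &
    forall z, r z = - 2^-1 * p z.

Record truncated_solution (f0 : R -> R -> R) f E : Prop := TruncatedSolution {
  trunc_f_space : forall t, in_time t ->
    space_X (fun z => (f z.1 z.2 t)%:C);
  trunc_E_space : forall t, in_time t -> space_F (fun x => (E x t)%:C);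
  trunc_f_cont_t : forall x v, vmin <= v <= vmax ->
    {within `[0, T[, continuous (f x v)};
  trunc_f_derivable : forall x v t, vmin < v < vmax -> 0 < t < T ->
    derivable (f x v) t 1;
  trunc_vlasov : forall t, 0 < t < T ->
    exists2 r, is_boundary_residual f E t r &
      is_proj_X (fun z => (vlasov f E z.1 z.2 t)%:C) r;
  trunc_poisson : forall t, in_time t ->
    is_proj_F (fun x => (derive1 (E^~ t) x - charge_density f x t)%:C) (fun=> 0);
  trunc_initial :
    is_proj_X (fun z => (f0 z.1 z.2)%:C) (fun z => (f z.1 z.2 0)%:C);
  trunc_normalized : forall t, in_time t ->
    normalized_field [pred k : int | (`|k| <= NF)%N] f E t
}.

End Truncated.

End VlasovPoisson.

(* Main.v *)
Require Import Defs.
From mathcomp Require Import all_boot all_order all_algebra.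
From mathcomp Require Import all_classical all_reals all_analysis.
From mathcomp Require Import measurable_realfun complex.
From mathcomp Require Import ring lra zify.

Import Order.TTheory GRing.Theory Num.Theory.
Import numFieldNormedType.Exports.

Local Open Scope ring_scope.

Set Implicit Arguments.
Unset Strict Implicit.
Unset Printing Implicit Defensive.

(** Fix a time, let E be a field and f the distribution function it comes
    from.  The normalization E_k = (i / k) f_k, E_0 = 0 of the Fourier
    coefficients reads, in real form,
      int E(x) cos k(x - x0) dx = 1/k int f(x, v) sin k(x - x0) dx dv
    for k > 0 and every x0, together with int E = 0; this is [mode_relation].
    For the exact solution it holds for all k by hypothesis ([exact_modes]).
    For the truncated solution it holds by hypothesis when k <= NF, and it
    holds when k > NF because both sides vanish: neither E^N nor f^N has
    modes beyond NF ([truncated_modes]).  The relation is linear, so it passes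
    to D = E - E^N and u = f - f^N.

    The claim then follows from the pointwise bound |D| <= int |u|, valid for
    every continuous D in this relation with an integrable u
    ([mode_relation_upper], [mode_relation_bound]).  The bound is a duality
    argument that replaces Parseval's identity and the completeness of the
    trigonometric system.  Let P(y) = c + sum_k a_k cos ky be nonnegative and
    put Q(y) = sum_k (a_k / k) sin ky.  The relation gives
      int D(x) P(x - x0) dx = int u Q(x - x0) dx dv.
    Since Q' = P - c, the function c y + Q(y) is nondecreasing; it vanishes at
    0 and equals 2 pi c at 2 pi, whence |Q| <= 2 pi c = int P
    ([cosine_poly_primitive_bound]).  So the average of D against the density
    P(x - x0) / int P is at most int |u|, and letting P concentrate at x0,
    with P a large power of a multiple of 1 + cos, yields D(x0) <= int |u|
    ([cosine_poly_localization]).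

    Finally, Omega_x has length 2 pi and Omega has measure 2 pi |Omega_v|, so
    that by Cauchy-Schwarz
      ||D|| <= sqrt(2 pi) sup |D| <= sqrt(2 pi) int |u|
            <= sqrt(2 pi) sqrt(2 pi |Omega_v|) ||u||,
    that is, C = 2 pi. *)

(** * Integrals of real-valued functions *)

Section RealIntegrals.
Local Open Scope classical_set_scope.
Variable R : realType.

Lemma integrable_EFinZ d (U : measurableType d) (mu : {measure set U -> \bar R})
    (A : set U) (k : R) (F : U -> R) :
  measurable A -> mu.-integrable A (EFin \o F) ->
  mu.-integrable A (EFin \o (fun z => k * F z)).
Proof.
move=> mA iF.
apply: (eq_integrable mA (fun z => k%:E * (EFin \o F) z)%E); last exact: integrableZl.
by move=> z _ /=; rewrite EFinM.
Qed.

Lemma integrable_EFinD d (U : measurableType d) (mu : {measure set U -> \bar R})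
    (A : set U) (F G : U -> R) :
  measurable A -> mu.-integrable A (EFin \o F) -> mu.-integrable A (EFin \o G) ->
  mu.-integrable A (EFin \o (fun z => F z + G z)).
Proof.
move=> mA iF iG.
apply: (eq_integrable mA ((EFin \o F) \+ (EFin \o G))%E); last exact: integrableD.
by move=> z _ /=; rewrite EFinD.
Qed.

Lemma integrable_EFinB d (U : measurableType d) (mu : {measure set U -> \bar R})
    (A : set U) (F G : U -> R) :
  measurable A -> mu.-integrable A (EFin \o F) -> mu.-integrable A (EFin \o G) ->
  mu.-integrable A (EFin \o (fun z => F z - G z)).
Proof.
move=> mA iF iG.
apply: (eq_integrable mA ((EFin \o F) \- (EFin \o G))%E); last exact: integrableB.
by move=> z _ /=; rewrite EFinB.
Qed.

Lemma integrable_EFinM_le1 d (U : measurableType d) (mu : {measure set U -> \bar R})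
    (A : set U) (F h : U -> R) :
  measurable A -> mu.-integrable A (EFin \o F) ->
  measurable_fun A h -> (forall z, `|h z| <= 1) ->
  mu.-integrable A (EFin \o (fun z => F z * h z)).
Proof.
move=> mA iF mh h1.
apply: (eq_integrable mA ((EFin \o F) \* (EFin \o h))%E).
  by move=> z _ /=; rewrite EFinM.
apply: integrableMl => //; exists 1; split; first by rewrite realE ler01.
by move=> M M1 z _ /=; rewrite (le_trans (h1 _))// ltW.
Qed.

Lemma integrable_EFin_sum d (U : measurableType d) (mu : {measure set U -> \bar R})
    (A : set U) (n : nat) (F : 'I_n -> U -> R) :
  measurable A -> (forall i, mu.-integrable A (EFin \o F i)) ->
  mu.-integrable A (EFin \o (fun z => \sum_(i < n) F i z)).
Proof.
move=> mA iF; apply: eq_integrable; last first.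
- by apply: (@integrable_sum _ _ _ mu A mA _ (index_enum 'I_n) xpredT) => i _; exact: iF.
- by move=> z _ /=; rewrite sumEFin.
- by [].
Qed.

Lemma Rintegral_sum d (U : measurableType d) (mu : {measure set U -> \bar R})
    (A : set U) (n : nat) (F : 'I_n -> U -> R) :
  measurable A -> (forall i, mu.-integrable A (EFin \o F i)) ->
  \int[mu]_(z in A) (\sum_(i < n) F i z) = \sum_(i < n) \int[mu]_(z in A) F i z.
Proof.
move=> mA; elim: n F => [|n IH] F iF.
  under eq_Rintegral do rewrite big_ord0.
  by rewrite big_ord0 Rintegral_cst// mul0r.
under eq_Rintegral do rewrite big_ord_recr /=.
by rewrite RintegralD ?IH ?big_ord_recr//; exact: integrable_EFin_sum.
Qed.

End RealIntegrals.

(** * Waves over one period *)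

Section OnePeriod.
Local Open Scope classical_set_scope.
Variable R : realType.

Lemma two_pi_gt0 : 0 < 2 * pi :> R.
Proof. by rewrite mulr_gt0 ?pi_gt0. Qed.

Lemma measurable_Omega_x : measurable (@Omega_x R).
Proof. exact: measurable_itv. Qed.

Lemma measure_Omega_x : leb1 R (@Omega_x R) = (2 * pi)%:E.
Proof.
have -> : leb1 R (@Omega_x R) = (if 0 < 2 * pi :> R then 2 * pi - 0 else 0)%:E.
  by have := lebesgue_measure_itv `[0 : R, 2 * pi[%R; rewrite /= lte_fin => ->; case: ifP.
by rewrite two_pi_gt0 subr0.
Qed.

Lemma continuous_integrable_Omega_x g : continuous g ->
  (leb1 R).-integrable (@Omega_x R) (EFin \o g).
Proof.
move=> cg; apply: (@integrableS _ (measurableTypeR R) R (leb1 R) `[0, 2 * pi]) => //.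
- exact: measurable_Omega_x.
- by apply: subset_itvl; rewrite bnd_simp.
- apply: continuous_compact_integrable; first exact: segment_compact.
  exact: continuous_subspaceT.
Qed.

Lemma continuous_sum_ord (n : nat) (F : 'I_n -> R -> R) :
  (forall i, continuous (F i)) -> continuous (fun x => \sum_(i < n) F i x).
Proof.
move=> cF; elim: n F cF => [|n IH] F cF.
  have -> : (fun x => \sum_(i < 0) F i x) = cst 0.
    by apply/funext => x; rewrite big_ord0.
  by move=> x; exact: cvg_cst.
have -> : (fun x => \sum_(i < n.+1) F i x) =
    (fun x => \sum_(i < n) F (widen_ord (leqnSn n) i) x + F ord_max x).
  by apply/funext => x; rewrite big_ord_recr.
by move=> x; apply: cvgD; [exact: IH | exact: cF].
Qed.

Lemma continuous_wave (m b : R) : continuous (fun x => cos (m * x + b)).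
Proof.
move=> x; apply: (@continuous_comp _ _ _ (fun x => m * x + b) (@cos R)).
  by apply: cvgD; [apply: cvgM; [exact: cvg_cst | exact: cvg_id] | exact: cvg_cst].
exact: continuous_cos.
Qed.

Lemma continuous_dilation (F : R -> R) (k x0 : R) : continuous F ->
  continuous (fun x => F (k * (x - x0))).
Proof.
move=> cF x; apply: (@continuous_comp _ _ _ (fun x => k * (x - x0)) F).
  by apply: cvgM; [exact: cvg_cst | apply: cvgB; [exact: cvg_id | exact: cvg_cst]].
exact: cF.
Qed.

Lemma continuous_translation (F : R -> R) (x0 : R) : continuous F ->
  continuous (fun x => F (x - x0)).
Proof.
move=> cF x; apply: (@continuous_comp _ _ _ (fun x => x - x0) F); last exact: cF.
by apply: cvgB; [exact: cvg_id | exact: cvg_cst].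
Qed.

Lemma sin_int2pi (m : int) (b : R) : sin (m%:~R * (2 * pi) + b) = sin b.
Proof.
have H (n : nat) (y : R) : sin (y + pi *+ 2 *+ n) = sin y.
  exact: (periodicn (@sinD2pi R)).
have E n : n%:R * (2 * pi) = pi *+ 2 *+ n :> R by rewrite mulr_natl mulr_natl.
case: m => n.
  by rewrite pmulrn E addrC H.
rewrite NegzE mulrNz mulNr pmulrn E -[in RHS](subrK (pi *+ 2 *+ n.+1) b) H.
by rewrite addrC.
Qed.

Lemma integral_wave (m : int) (b : R) : m != 0 ->
  \int[leb1 R]_(x in @Omega_x R) cos (m%:~R * x + b) = 0.
Proof.
move=> m0; have mr0 : m%:~R != 0 :> R by rewrite intr_eq0.
pose S := fun x : R => m%:~R^-1 * sin (m%:~R * x + b).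
have dS (x : R) : is_derive x 1 S (cos (m%:~R * x + b)).
  rewrite /S; apply: is_derive_eq; rewrite /GRing.scale /=.
  by field.
rewrite /Omega_x Rintegral_itv_bndo_bndc; last first.
  exact: (continuous_integrable_Omega_x (@continuous_wave m%:~R b)).
have cS : continuous S.
  by move=> x; apply: differentiable_continuous; apply/derivable1_diffP; case: (dS x).
rewrite /Rintegral /leb1 (@continuous_FTC2 _ _ S) ?two_pi_gt0//.
- by rewrite -EFinB /= /S sin_int2pi mulr0 add0r subrr.
- exact/continuous_subspaceT/continuous_wave.
- split; first by move=> x _; case: (dS x).
  + exact/cvg_at_right_filter/cS.
  + exact/cvg_at_left_filter/cS.
- by move=> x _; rewrite derive1E; have /@derive_val -> := dS x.
Qed.

Lemma sin_as_cos (y : R) : sin y = cos (y + - (pi / 2)).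
Proof. by rewrite cosBpihalf. Qed.

Lemma cos_prod (y z : R) : cos y * cos z = 2^-1 * (cos (y + z) + cos (y - z)).
Proof. by rewrite cosD cosB; field. Qed.

(** The phases b and c are free so that one statement covers all products of
    sines and cosines: a sine is a cosine shifted by pi / 2. *)
Lemma integral_wave_prod (j k : int) (b c : R) : j + k != 0 -> j - k != 0 ->
  \int[leb1 R]_(x in @Omega_x R) (cos (j%:~R * x + b) * cos (k%:~R * x + c)) = 0.
Proof.
move=> jk jk'.
have E (x : R) : cos (j%:~R * x + b) * cos (k%:~R * x + c) =
    2^-1 * (cos ((j + k)%:~R * x + (b + c)) + cos ((j - k)%:~R * x + (b - c))).
  by rewrite cos_prod intrD intrB; congr (_ * (cos _ + cos _)); ring.
under eq_Rintegral do rewrite E.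
have i1 := continuous_integrable_Omega_x (@continuous_wave (j + k)%:~R (b + c)).
have i2 := continuous_integrable_Omega_x (@continuous_wave (j - k)%:~R (b - c)).
rewrite RintegralZl ?RintegralD ?integral_wave ?addr0 ?mulr0//;
  [exact: measurable_Omega_x | exact: measurable_Omega_x |].
apply: (continuous_integrable_Omega_x (g := fun x => _ + _)) => x.
by apply: cvgD; exact: continuous_wave.
Qed.

(** The real functions in the span of the waves of wave number at most NF. *)
Definition trig_poly (NF : nat) (a b : int -> R) (x : R) : R :=
  \sum_(j < (2 * NF).+1)
    (a (wave j) * cos ((wave j)%:~R * x) + b (wave j) * sin ((wave j)%:~R * x)).

Lemma integral_trig_poly_wave (NF k : nat) (a b : int -> R) (c : R) :
  (NF < k)%N ->
  \int[leb1 R]_(x in @Omega_x R)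
    (trig_poly NF a b x * cos (k%:R * x + c)) = 0.
Proof.
move=> NFk; rewrite /trig_poly; under eq_Rintegral do rewrite mulr_suml.
have E (j : 'I_(2 * NF).+1) (x : R) :
   (a (wave j) * cos ((wave j)%:~R * x) + b (wave j) * sin ((wave j)%:~R * x))
     * cos (k%:R * x + c) =
   a (wave j) * (cos ((wave j)%:~R * x + 0) * cos ((k%:Z)%:~R * x + c)) +
   b (wave j) * (cos ((wave j)%:~R * x + - (pi / 2)) * cos ((k%:Z)%:~R * x + c)).
  by rewrite sin_as_cos addr0 -pmulrn; ring.
have cont (j : 'I_(2 * NF).+1) d : continuous (fun x : R =>
    cos ((wave j)%:~R * x + d) * cos ((k%:Z)%:~R * x + c)).
  by move=> x; apply: cvgM; exact: continuous_wave.
have contZ (j : 'I_(2 * NF).+1) d (e : R) : continuous (fun x : R =>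
    e * (cos ((wave j)%:~R * x + d) * cos ((k%:Z)%:~R * x + c))).
  by move=> x; apply: cvgM; [exact: cvg_cst | exact: cont].
have orth (j : 'I_(2 * NF).+1) d : \int[leb1 R]_(x in @Omega_x R)
    (cos ((wave j)%:~R * x + d) * cos ((k%:Z)%:~R * x + c)) = 0.
  by apply: integral_wave_prod; have := ltn_ord j; rewrite /wave; lia.
under eq_Rintegral do under eq_bigr do rewrite E.
rewrite Rintegral_sum; last 2 first.
- exact: measurable_Omega_x.
- move=> j; apply: (continuous_integrable_Omega_x (g := fun x => _ + _)) => x.
  by apply: cvgD; exact: contZ.
apply: big1 => j _; rewrite RintegralD; last 3 first.
- exact: measurable_Omega_x.
- exact/continuous_integrable_Omega_x/contZ.
- exact/continuous_integrable_Omega_x/contZ.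
rewrite !RintegralZl ?orth ?mulr0 ?addr0//;
  by [exact: measurable_Omega_x | exact/continuous_integrable_Omega_x/cont].
Qed.

Lemma trig_poly_continuous (NF : nat) (a b : int -> R) :
  continuous (trig_poly NF a b).
Proof.
apply: (@continuous_sum_ord _ (fun j (x : R) => a (wave j) * cos ((wave j)%:~R * x)
  + b (wave j) * sin ((wave j)%:~R * x))) => j x.
have cC := @continuous_dilation cos (wave j)%:~R 0 (@continuous_cos R).
have cS := @continuous_dilation sin (wave j)%:~R 0 (@continuous_sin R).
under eq_fun do rewrite -[X in _ * cos (_ * X)]subr0 -[X in _ * sin (_ * X)]subr0.
by apply: cvgD; apply: cvgM; [exact: cvg_cst | exact: cC | exact: cvg_cst | exact: cS].
Qed.

End OnePeriod.

(** * Cosine polynomials and their primitives *)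

Section CosinePolynomials.
Local Open Scope classical_set_scope.
Variable R : realType.

(** [cosine_poly c P Q]: P is a polynomial sum_k a_k cos ky with constant term
    c, and Q = sum_(k > 0) (a_k / k) sin ky.  Carrying c and Q along with P
    makes every linear fact about the triple a four-case induction, with no
    manipulation of coefficient sequences. *)
Inductive cosine_poly : R -> (R -> R) -> (R -> R) -> Prop :=
| Cosine_cst a : cosine_poly a (fun=> a) (fun=> 0)
| Cosine_wave k : (0 < k)%N ->
    cosine_poly 0 (fun y => cos (k%:R * y)) (fun y => k%:R^-1 * sin (k%:R * y))
| CosineD c P Q c' P' Q' : cosine_poly c P Q -> cosine_poly c' P' Q' ->
    cosine_poly (c + c') (fun y => P y + P' y) (fun y => Q y + Q' y)
| CosineZ a c P Q : cosine_poly c P Q ->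
    cosine_poly (a * c) (fun y => a * P y) (fun y => a * Q y).

(** The span of the cos ky is an algebra generated by cos y, because
    cos y cos ky = (cos (k - 1)y + cos (k + 1)y) / 2; the case k = 1 produces
    a constant term.  This is what makes powers of 1 + cos available as test
    functions. *)
Lemma cosine_poly_mulcos c P Q : cosine_poly c P Q ->
  exists c' Q', cosine_poly c' (fun y => cos y * P y) Q'.
Proof.
elim=> {c P Q}.
- move=> a; exists (a * 0), (fun y => a * (1%:R^-1 * sin (1%:R * y))).
  have -> : (fun y => cos y * a) = (fun y : R => a * cos (1%:R * y)).
    by apply/funext => y; rewrite mul1r mulrC.
  exact/CosineZ/Cosine_wave.
- case=> // -[|k] _.
    eexists _, _.
    have -> : (fun y => cos y * cos (1%:R * y)) =
        (fun y : R => 2^-1 * (1 + cos (2%:R * y))).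
      apply/funext => y; rewrite mul1r mulr_natl cos_mulr2n mulr2n expr2.
      by field.
    by apply/CosineZ/CosineD; [exact: Cosine_cst | exact: Cosine_wave].
  eexists _, _.
  have -> : (fun y => cos y * cos (k.+2%:R * y)) =
        (fun y : R => 2^-1 * (cos (k.+1%:R * y) + cos (k.+3%:R * y))).
    apply/funext => y; rewrite mulrC cos_prod addrC -!natr1.
    by congr (_ * (cos _ + cos _)); ring.
  by apply/CosineZ/CosineD; exact: Cosine_wave.
- move=> c P Q c' P' Q' _ [d [S dS]] _ [d' [S' dS']].
  eexists _, _; under eq_fun do rewrite mulrDr; exact: CosineD dS dS'.
- move=> a c P Q _ [d [S dS]].
  eexists _, _; under eq_fun do rewrite mulrCA; exact: CosineZ dS.
Qed.

Lemma cosine_poly_exp (a : R) n :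
  exists c Q, cosine_poly c (fun y => (a * (1 + cos y)) ^+ n) Q.
Proof.
elim: n => [|n [c [Q PQ]]].
  by exists 1, (fun=> 0); under eq_fun do rewrite expr0; exact: Cosine_cst.
have [d [S dS]] := cosine_poly_mulcos PQ.
eexists _, _.
have -> : (fun y => (a * (1 + cos y)) ^+ n.+1) =
   (fun y => a * ((a * (1 + cos y)) ^+ n + cos y * (a * (1 + cos y)) ^+ n)).
  by apply/funext => y; rewrite exprS; ring.
by apply/CosineZ/CosineD; [exact: PQ | exact: dS].
Qed.

Lemma is_derive_cosine_poly c P Q : cosine_poly c P Q ->
  forall y : R, is_derive y (1:R) Q (P y - c).
Proof.
elim=> {c P Q}.
- by move=> a y; rewrite subrr; exact: is_derive_cst.
- move=> k k0 y; have kr0 : k%:R != 0 :> R by rewrite pnatr_eq0 -lt0n.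
  by apply: is_derive_eq; rewrite /GRing.scale /=; field.
- move=> c P Q c' P' Q' _ IH _ IH' y.
  by apply: is_derive_eq; ring.
- move=> a c P Q _ IH y.
  by apply: is_derive_eq; rewrite /GRing.scale /=; ring.
Qed.

Lemma cosine_poly_parity c P Q : cosine_poly c P Q ->
  forall y : R, P (- y) = P y /\ Q (- y) = - Q y.
Proof.
elim=> {c P Q}.
- by move=> a y; rewrite oppr0.
- by move=> k k0 y; rewrite mulrN cosN sinN mulrN.
- move=> c P Q c' P' Q' _ IH _ IH' y.
  by have [-> ->] := IH y; have [-> ->] := IH' y; rewrite opprD.
- by move=> a c P Q _ IH y; have [-> ->] := IH y; rewrite mulrN.
Qed.

Lemma cosine_poly_2pi c P Q : cosine_poly c P Q -> Q (2 * pi) = 0.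
Proof.
elim=> {c P Q} //.
- move=> k k0; have := @sin_int2pi R k%:Z 0.
  by rewrite !addr0 sin0 -pmulrn => ->; rewrite mulr0.
- by move=> c P Q c' P' Q' _ -> _ ->; rewrite addr0.
- by move=> a c P Q _ ->; rewrite mulr0.
Qed.

Lemma cosine_poly_continuous c P Q : cosine_poly c P Q ->
  continuous P /\ continuous Q.
Proof.
move=> PQ; split; last first.
  move=> y; apply: differentiable_continuous; apply/derivable1_diffP.
  by case: (is_derive_cosine_poly PQ y).
elim: PQ => {c P Q}.
- by move=> a y; exact: cvg_cst.
- move=> k k0 y; have := @continuous_wave R k%:R 0 y.
  by under eq_fun do rewrite addr0.
- by move=> c P Q c' P' Q' _ IH _ IH' y; apply: cvgD; [exact: IH | exact: IH'].
- by move=> a c P Q _ IH y; apply: cvgM; [exact: cvg_cst | exact: IH].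
Qed.

Lemma cosine_poly_integral c P Q (x0 : R) : cosine_poly c P Q ->
  \int[leb1 R]_(x in @Omega_x R) P (x - x0) = 2 * pi * c.
Proof.
move=> PQ.
have cont (c' : R) P' Q' : cosine_poly c' P' Q' -> continuous (fun x => P' (x - x0)).
  by move=> PQ'; apply: continuous_translation (cosine_poly_continuous PQ').1.
elim: PQ => {c P Q}.
- move=> a; rewrite Rintegral_cst; last exact: measurable_Omega_x.
  by rewrite measure_Omega_x /= mulrC.
- move=> k k0; rewrite mulr0.
  have E (x : R) : cos (k%:R * (x - x0)) = cos ((k%:Z)%:~R * x + - (k%:R * x0)).
    by rewrite -pmulrn mulrBr.
  by under eq_Rintegral do rewrite E; rewrite integral_wave//; lia.
- move=> c P Q c' P' Q' h IH h' IH'; rewrite RintegralD ?IH ?IH' ?mulrDr//.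
  + exact: measurable_Omega_x.
  + exact/continuous_integrable_Omega_x/(cont _ _ _ h).
  + exact/continuous_integrable_Omega_x/(cont _ _ _ h').
- move=> a c P Q h IH; rewrite RintegralZl ?IH 1?mulrCA//.
  + exact: measurable_Omega_x.
  + exact/continuous_integrable_Omega_x/(cont _ _ _ h).
Qed.

(** The function c y + Q(y) has derivative P >= 0, so on [0, 2 pi] it lies
    between its end values 0 and 2 pi c, as does c y; their difference Q is
    then at most 2 pi c in absolute value.  Oddness of Q covers negative y.
    For x and x0 in [0, 2 pi] the point x - x0 is in the range considered. *)
Lemma cosine_poly_primitive_bound c P Q : cosine_poly c P Q ->
  (forall y, 0 <= P y) -> forall y, `|y| <= 2 * pi -> `|Q y| <= 2 * pi * c.
Proof.
move=> PQ P0.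
have dH (y : R) : is_derive y (1:R) (fun y => c * y + Q y) (P y).
  have dQ := is_derive_cosine_poly PQ y.
  by apply: is_derive_eq; rewrite /GRing.scale /=; ring.
have Hmono (x y : R) : x <= y -> c * x + Q x <= c * y + Q y.
  move=> xy; rewrite -subr_ge0.
  have [|z _ ->] := @MVT_segment R (fun y => c * y + Q y) P x y xy (fun z _ => dH z).
    apply: continuous_subspaceT => z; apply: differentiable_continuous.
    by apply/derivable1_diffP; case: (dH z).
  by rewrite mulr_ge0// subr_ge0.
have Q0 : Q 0 = 0.
  by have [_] := cosine_poly_parity PQ 0; rewrite oppr0; lra.
have pos y : 0 <= y <= 2 * pi -> `|Q y| <= 2 * pi * c.
  move=> /andP[y0 y2]; have := Hmono _ _ y0; have := Hmono _ _ y2.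
  rewrite Q0 (cosine_poly_2pi PQ) mulr0 !addr0 => h1 h2.
  have c0 : 0 <= c.
    by have := le_trans h2 h1; rewrite pmulr_lge0// two_pi_gt0.
  have := ler_wpM2l c0 y2; have := mulr_ge0 c0 y0.
  by rewrite ler_norml; lra.
move=> y; have [y0|y0] := leP 0 y.
  by rewrite (ger0_norm y0) => hy; apply: pos; rewrite y0.
rewrite (ltr0_norm y0) => hy.
by rewrite -normrN -(cosine_poly_parity PQ y).2 pos// hy oppr_ge0 ltW.
Qed.

End CosinePolynomials.

(** * Concentration of cosine polynomials at a point *)

Section Localization.
Local Open Scope classical_set_scope.
Variable R : realType.

Lemma continuous_bounded_itv (g : R -> R) (a b : R) : a <= b -> continuous g ->
  exists B, forall x, a <= x <= b -> `|g x| <= B.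
Proof.
move=> ab cg; have cn : {within `[a, b], continuous (fun x => `|g x|)}.
  apply: continuous_subspaceT => x.
  by apply: (@continuous_comp _ _ _ g); [exact: cg | exact: norm_continuous].
by have [z _ hz] := EVT_max ab cn; exists `|g z| => x hx; apply: hz; rewrite in_itv.
Qed.

Lemma cos_le_outside (d y : R) : 0 <= d <= pi -> d <= `|y| <= 2 * pi - d ->
  cos y <= cos d.
Proof.
move=> /andP[d0 dpi] /andP[dy yd]; rewrite -cos_norm.
have decr (z : R) : d <= z <= pi -> cos z <= cos d.
  move=> /andP[dz zpi]; rewrite leNgt ltr_cos ?in_itv/= ?d0 ?dpi//.
    by rewrite -leNgt.
  by rewrite zpi (le_trans d0).
have [ypi|ypi] := leP `|y| pi; first by apply: decr; rewrite dy.
have -> : cos `|y| = cos (2 * pi - `|y|).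
  by rewrite -(cosN (2 * pi - _)) opprB -(cosD2pi (_ - _)) mulr_natl subrK.
by apply: decr; lra.
Qed.

Lemma bernoulli_inequality (q : R) n : 0 <= q -> 1 + n%:R * q <= (1 + q) ^+ n.
Proof.
move=> q0; elim: n => [|n IH]; first by rewrite mul0r addr0 expr0.
rewrite exprS; apply: le_trans (ler_wpM2l _ IH); last by rewrite addr_ge0.
have : 0 <= n%:R * q * q by rewrite !mulr_ge0.
by rewrite -natr1; lra.
Qed.

(** Nonnegative cosine polynomials detect the sign of h at x0.  If h >= e > 0
    near x0, take P = T ^ n with T(y) = (1 + cos y) / (1 + cos d).  Then
    T >= 1 + q > 1 for |y| <= d / 2, while T <= 1 once |y| >= d, so the part
    of int h P near x0 grows geometrically in n and the rest stays bounded
    below: the integral is eventually positive. *)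
Lemma cosine_poly_localization (h : R -> R) (x0 : R) : continuous h ->
  0 < x0 < 2 * pi ->
  (forall c P Q, cosine_poly c P Q -> (forall y, 0 <= P y) ->
    \int[leb1 R]_(x in @Omega_x R) (h x * P (x - x0)) <= 0) ->
  h x0 <= 0.
Proof.
move=> ch /andP[x0_gt0 x0_lt] H; rewrite leNgt; apply/negP => h0.
(* Half of h x0, so that h stays above e on a neighbourhood of x0. *)
pose e := h x0 / 2.
have e0 : 0 < e by rewrite /e divr_gt0.
have [d0 d00 hd0] : exists2 d0 : R, 0 < d0 & forall x : R, `|x - x0| < d0 -> e <= h x.
  have /cvgrPdist_le/(_ e e0)/nbhs_ballP[d0 /= d00 Hd] := ch x0.
  exists d0 => // x; rewrite distrC => /Hd /=; rewrite ler_norml /e; lra.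
have pi2 := pi_ge2 R.
(* d <= 1 < pi keeps 1 + cos d positive; the bounds by x0 and 2 pi - x0 keep
   |x - x0| <= 2 pi - d on the period, away from the next peak of P. *)
pose d : R := Num.min (Num.min d0 1) (Num.min x0 (2 * pi - x0)).
have d_gt0 : 0 < d by rewrite !lt_min d00 ltr01 x0_gt0 subr_gt0.
have [dd0 d1 dx0 dx0'] : [/\ d <= d0, d <= 1, d <= x0 & d <= 2 * pi - x0].
  by split; rewrite /d !ge_min lexx ?orbT.
have [B hB] : exists B : R, forall x : R, 0 <= x <= 2 * pi -> `|h x| <= B.
  exact: (continuous_bounded_itv (ltW (two_pi_gt0 R)) ch).
have B0 : 0 <= B.
  by apply: le_trans (hB 0 _) => //; rewrite lexx ltW// two_pi_gt0.
pose c := 1 + cos d.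
have c_gt0 : 0 < c.
  have : cos pi < cos d by rewrite ltr_cos ?in_itv/=; lra.
  by rewrite cospi /c; lra.
(* 1 + q is the value at d / 2 of T below. *)
pose q := (cos (d / 2) - cos d) / c.
have q_gt0 : 0 < q.
  by rewrite divr_gt0// subr_gt0 ltr_cos ?in_itv/=; lra.
pose T y := c^-1 * (1 + cos y).
have T0 y : 0 <= T y.
  by rewrite mulr_ge0 ?invr_ge0 ?(ltW c_gt0)//; have := cos_geN1 y; lra.
have Tin y : `|y| <= d / 2 -> 1 + q <= T y.
  move=> yd; have : cos (d / 2) <= cos y.
    rewrite -(cos_norm y) leNgt ltr_cos ?in_itv/= ?normr_ge0 -?leNgt//.
      by lra.
    by apply/andP; lra.
  rewrite /T /q => cc.
  have -> : 1 + (cos (d / 2) - cos d) / c = c^-1 * (1 + cos (d / 2)).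
    by rewrite /c; field; rewrite -/c gt_eqF.
  by rewrite ler_wpM2l ?invr_ge0 ?(ltW c_gt0)// lerD2l.
have Tout y : d <= `|y| <= 2 * pi - d -> T y <= 1.
  move=> /cos_le_outside-/(_ _)/= h1; rewrite /T mulrC ler_pdivrMr// mul1r lerD2l.
  by apply: h1; lra.
pose I : set R := `[x0 - d / 2, x0 + d / 2].
have mI : measurable (I : set (measurableTypeR R)) by exact: measurable_itv.
have IO : I `<=` @Omega_x R.
  by move=> x; rewrite /I /Omega_x /= !in_itv/=; lra.
(* Integrate h P >= e (1 + q) ^ n 1_I - B over the period; I has length d. *)
have key n : e * d * (1 + q) ^+ n <= 2 * pi * B.
  have [a [Q PQ]] := cosine_poly_exp c^-1 n.
  have P0 y : 0 <= (c^-1 * (1 + cos y)) ^+ n by rewrite exprn_ge0// T0.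
  have := H _ _ _ PQ P0.
  have iI : (leb1 R).-integrable (@Omega_x R) (EFin \o (\1_I : R -> R)).
    apply: (@integrableS _ (measurableTypeR R) R (leb1 R) setT) => //.
      exact: measurable_Omega_x.
    exact: (integrable_indic_itv (x0 - d / 2) (x0 + d / 2) true false).
  have iI' : (leb1 R).-integrable (@Omega_x R)
     (EFin \o (fun x => e * (1 + q) ^+ n * \1_I x)).
    exact: (integrable_EFinZ _ (@measurable_Omega_x R) iI).
  have icst : (leb1 R).-integrable (@Omega_x R) (EFin \o (fun=> B)).
    by apply: continuous_integrable_Omega_x => x; exact: cvg_cst.
  have cP : continuous (fun x => h x * (c^-1 * (1 + cos (x - x0))) ^+ n).
    move=> x; apply: cvgM; first exact: ch.
    exact: (continuous_translation (cosine_poly_continuous PQ).1).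
  have : \int[leb1 R]_(x in @Omega_x R) (e * (1 + q) ^+ n * \1_I x - B) <=
      \int[leb1 R]_(x in @Omega_x R) (h x * (c^-1 * (1 + cos (x - x0))) ^+ n).
    apply: le_Rintegral.
    - exact: measurable_Omega_x.
    - exact: (integrable_EFinB (@measurable_Omega_x R) iI' icst).
    - exact: continuous_integrable_Omega_x.
    move=> x; rewrite /Omega_x /= in_itv/= => /andP[x_ge0 x_lt].
    rewrite -[c^-1 * _]/(T (x - x0)).
    have [xd|xd] := leP `|x - x0| (d / 2).
      have -> : \1_I x = 1 :> R.
        rewrite indicE mem_set// /I /= in_itv/=.
        by move: xd; rewrite ler_norml; lra.
      rewrite mulr1; apply: (@le_trans _ _ (e * (1 + q) ^+ n)); first by rewrite lerBlDr lerDl.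
      apply: ler_pM; [exact: ltW | by rewrite exprn_ge0// addr_ge0// ltW | |].
        by apply: hd0; lra.
      by apply: lerXn2r; rewrite ?nnegrE ?T0 ?Tin// addr_ge0// ltW.
    have -> : \1_I x = 0 :> R.
      rewrite indicE memNset// /I /= in_itv/= => Ix.
      by move: xd; rewrite ltNge ler_norml; lra.
    rewrite mulr0 sub0r; have [xd'|xd'] := ltP `|x - x0| d.
      apply: (@le_trans _ _ 0); first by rewrite oppr_le0.
      rewrite mulr_ge0 ?exprn_ge0//; apply: le_trans (ltW e0) _.
      by apply: hd0; lra.
    have : `|h x * T (x - x0) ^+ n| <= B.
      rewrite normrM -[leRHS]mulr1; apply: ler_pM => //.
        by apply: hB; rewrite x_ge0 ltW.
      rewrite ger0_norm ?exprn_ge0// exprn_ile1//; apply: Tout; rewrite xd' /=.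
      by rewrite ler_norml; lra.
    by rewrite ler_norml => /andP[].
  rewrite RintegralB//; last exact: measurable_Omega_x.
  rewrite RintegralZl//; last exact: measurable_Omega_x.
  rewrite Rintegral_cst; last exact: measurable_Omega_x.
  have -> : \int[leb1 R]_(x in @Omega_x R) \1_I x = d.
    rewrite /Rintegral integral_indic//; last exact: measurable_Omega_x.
    rewrite setIidl//.
    have -> : leb1 R I = (if x0 - d / 2 < x0 + d / 2 then x0 + d / 2 - (x0 - d / 2) else 0)%:E.
      have := lebesgue_measure_itv `[x0 - d / 2, x0 + d / 2]%R.
      by rewrite /= lte_fin => ->; case: ifP.
    by rewrite ifT /=; lra.
  by rewrite measure_Omega_x /=; lra.
have edq : 0 < e * d * q by exact: mulr_gt0 (mulr_gt0 e0 d_gt0) q_gt0.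
(* By Bernoulli's inequality this n makes e d (1 + q) ^ n.+1 exceed 2 pi B. *)
pose n := Num.truncn (2 * pi * B / (e * d * q)).
have := truncnS_gt (2 * pi * B / (e * d * q)); rewrite -/n ltr_pdivrMr// => hn.
have := key n.+1; have := bernoulli_inequality n.+1 (ltW q_gt0).
move/(ler_wpM2l (ltW (mulr_gt0 e0 d_gt0))).
have : 0 < e * d by rewrite mulr_gt0.
by rewrite -natr1; move: hn; rewrite -natr1; nra.
Qed.

(** The concentration argument is run at interior points of the period only;
    the endpoint 0 of Omega_x is reached by continuity. *)
Lemma norm_bound_left_endpoint (D : R -> R) (M : R) : continuous D ->
  (forall x, 0 < x < 2 * pi -> `|D x| <= M) ->
  forall x, 0 <= x < 2 * pi -> `|D x| <= M.
Proof.
move=> cD DM x /andP[x_ge0 x_lt]; have [x_gt0|] := ltP 0 x.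
  by apply: DM; rewrite x_gt0.
move=> x_le0; have -> : x = 0 by apply/eqP; rewrite eq_le x_le0.
rewrite leNgt; apply/negP => MD.
have cn : {for 0, continuous (fun x => `|D x|)}.
  by apply: (@continuous_comp R _ _ D); [exact: cD | exact: norm_continuous].
have e0 : 0 < `|D 0| - M by rewrite subr_gt0.
have /cvgrPdist_lt/(_ _ e0)/nbhs_ballP[d /= d0 Hd] := cn.
have pi0 := two_pi_gt0 R.
pose y : R := Num.min (d / 2) pi.
have y0 : 0 < y by rewrite lt_min divr_gt0//= pi_gt0.
have yd : y <= d / 2 by rewrite /y ge_min lexx.
have yp : y <= pi by rewrite /y ge_min lexx orbT.
have := Hd y; rewrite /ball /= sub0r normrN gtr0_norm// => /(_ _).
have -> : y < d by move: d0 => /= d0; lra.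
move=> /(_ isT); have := DM y; rewrite ltr_norml; lra.
Qed.

End Localization.

(** * A uniform bound on a field by its source *)

Section FieldBound.
Local Open Scope classical_set_scope.
Variable R : realType.

Context d (U : measurableType d) (mu : {measure set U -> \bar R}).
Variables (A : set U) (X : U -> R).
Hypotheses (mA : measurable A) (mX : measurable_fun A X)
  (XA : forall z, A z -> 0 <= X z <= 2 * pi).

(** The identity D_k = (i / k) u_k between Fourier coefficients, with its real
    and imaginary parts merged into one identity by the free phase x0; X z is
    the space coordinate of the point z. *)
Definition mode_relation (D : R -> R) (u : U -> R) : Prop :=
  \int[leb1 R]_(x in @Omega_x R) D x = 0 /\
  forall (k : nat) (x0 : R), (0 < k)%N ->
    \int[leb1 R]_(x in @Omega_x R) (D x * cos (k%:R * (x - x0))) =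
    k%:R^-1 * \int[mu]_(z in A) (u z * sin (k%:R * (X z - x0))).

Lemma integrable_mul_sin (u : U -> R) (k x0 : R) :
  mu.-integrable A (EFin \o u) ->
  mu.-integrable A (EFin \o (fun z => u z * sin (k * (X z - x0)))).
Proof.
move=> iu.
apply: (integrable_EFinM_le1 mA iu (h := fun z => sin (k * (X z - x0)))) => [|z].
  apply: (@measurableT_comp _ _ _ _ _ _ (fun x : measurableTypeR R => sin (k * (x - x0)))) => //.
  apply: continuous_measurable_fun.
  exact: (continuous_dilation (@continuous_sin R)).
exact: sin_max.
Qed.

(** Linear combination of the modes.  The constant term of P contributes
    nothing since D has zero mean, which matches the fact that Q has no
    constant term. *)
Lemma mode_relation_cosine_poly D u (x0 : R) c P Q :
  continuous D -> mu.-integrable A (EFin \o u) -> mode_relation D u ->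
  cosine_poly c P Q ->
  mu.-integrable A (EFin \o (fun z => u z * Q (X z - x0))) /\
  \int[leb1 R]_(x in @Omega_x R) (D x * P (x - x0)) =
    \int[mu]_(z in A) (u z * Q (X z - x0)).
Proof.
move=> cD iu [D0 Dk].
have iDP (c' : R) P' Q' : cosine_poly c' P' Q' ->
    (leb1 R).-integrable (@Omega_x R) (EFin \o (fun x => D x * P' (x - x0))).
  move=> PQ; apply: continuous_integrable_Omega_x => x.
  apply: cvgM; first exact: cD.
  exact: (continuous_translation (cosine_poly_continuous PQ).1).
elim=> {c P Q}.
- move=> a; split.
    under eq_fun do rewrite mulr0; exact: integrable0.
  rewrite RintegralZr; last exact: continuous_integrable_Omega_x;
    last exact: measurable_Omega_x.
  under [RHS]eq_Rintegral do rewrite mulr0.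
  by rewrite D0 mul0r Rintegral_cst// mul0r.
- move=> k k0.
  have E z : u z * (k%:R^-1 * sin (k%:R * (X z - x0))) =
    k%:R^-1 * (u z * sin (k%:R * (X z - x0))) by rewrite mulrCA.
  split; first by under eq_fun do rewrite E; exact/integrable_EFinZ/integrable_mul_sin.
  under [RHS]eq_Rintegral do rewrite E.
  by rewrite Dk// RintegralZl//; exact: integrable_mul_sin.
- move=> c P Q c' P' Q' PQ [iuQ IH] PQ' [iuQ' IH']; split.
    by under eq_fun do rewrite mulrDr; exact: integrable_EFinD.
  under eq_Rintegral do rewrite mulrDr.
  under [RHS]eq_Rintegral do rewrite mulrDr.
  rewrite !RintegralD ?IH ?IH'//; [exact: measurable_Omega_x | exact: iDP PQ | exact: iDP PQ'].
- move=> a c P Q PQ [iuQ IH]; split.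
    by under eq_fun do rewrite mulrCA; exact: integrable_EFinZ.
  under eq_Rintegral do rewrite mulrCA.
  under [RHS]eq_Rintegral do rewrite mulrCA.
  rewrite !RintegralZl ?IH//; [exact: measurable_Omega_x | exact: iDP PQ].
Qed.

(** By [cosine_poly_localization] applied to D - int |u|, it suffices to test
    against nonnegative P, where
    int D P = int u Q <= (2 pi c) int |u| = (int P) (int |u|). *)
Lemma mode_relation_upper D u :
  continuous D -> mu.-integrable A (EFin \o u) -> mode_relation D u ->
  forall x : R, 0 < x < 2 * pi -> D x <= \int[mu]_(z in A) `|u z|.
Proof.
move=> cD iu Du x0 hx0; set M := (X in _ <= X).
rewrite -subr_le0; apply: (@cosine_poly_localization R (fun x => D x - M)) => //.
  by move=> x; apply: cvgB; [exact: cD | exact: cvg_cst].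
move=> c P Q PQ P0.
have [iuQ E] := mode_relation_cosine_poly x0 cD iu Du PQ.
have cP : continuous (fun x => P (x - x0)).
  exact: continuous_translation (cosine_poly_continuous PQ).1.
under eq_Rintegral do rewrite mulrBl.
rewrite RintegralB; last 3 first.
- exact: measurable_Omega_x.
- apply: continuous_integrable_Omega_x => x.
  by apply: cvgM; [exact: cD | exact: cP].
- apply: integrable_EFinZ; first exact: measurable_Omega_x.
  exact: continuous_integrable_Omega_x.
rewrite RintegralZl; last 2 first.
- exact: measurable_Omega_x.
- exact: continuous_integrable_Omega_x.
rewrite E (cosine_poly_integral _ PQ) subr_le0 mulrC -RintegralZl//; last exact: integrable_norm.
apply: le_Rintegral => //.
  exact/integrable_EFinZ/integrable_norm.
move=> z Az; apply: le_trans (ler_norm _) _; rewrite normrM mulrC.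
apply: ler_wpM2r => //; apply: (cosine_poly_primitive_bound PQ P0).
by have := XA Az; move: hx0; rewrite ler_norml; lra.
Qed.

Lemma mode_relationB D u D' u' :
  continuous D -> mu.-integrable A (EFin \o u) -> mode_relation D u ->
  continuous D' -> mu.-integrable A (EFin \o u') -> mode_relation D' u' ->
  mode_relation (fun x => D x - D' x) (fun z => u z - u' z).
Proof.
move=> cD iu [D0 Dk] cD' iu' [D0' Dk'].
have mx := @measurable_Omega_x R; have iC := @continuous_integrable_Omega_x R.
have cM (F : R -> R) (k : R) (y : R) : continuous F ->
    continuous (fun x => F x * cos (k * (x - y))).
  move=> cF w; apply: cvgM; first exact: cF.
  exact: (@continuous_dilation R cos k y (@continuous_cos R) w).
split=> [|k y k0]; first by rewrite RintegralB ?D0 ?D0' ?subr0//; exact: iC.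
under eq_Rintegral do rewrite mulrBl.
under [in RHS]eq_Rintegral do rewrite mulrBl.
rewrite RintegralB//; [|exact/iC/cM|exact/iC/cM].
rewrite RintegralB//; [|exact: integrable_mul_sin|exact: integrable_mul_sin].
by rewrite Dk// Dk'// mulrBr.
Qed.

(** Linearity turns the one-sided bound into a two-sided one, by exchanging
    the two pairs. *)
Lemma mode_relation_bound D u D' u' :
  continuous D -> mu.-integrable A (EFin \o u) -> mode_relation D u ->
  continuous D' -> mu.-integrable A (EFin \o u') -> mode_relation D' u' ->
  forall x : R, 0 < x < 2 * pi ->
    `|D x - D' x| <= \int[mu]_(z in A) `|u z - u' z|.
Proof.
have upper D1 u1 D2 u2 :
  continuous D1 -> mu.-integrable A (EFin \o u1) -> mode_relation D1 u1 ->
  continuous D2 -> mu.-integrable A (EFin \o u2) -> mode_relation D2 u2 ->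
  forall x : R, 0 < x < 2 * pi -> D1 x - D2 x <= \int[mu]_(z in A) `|u1 z - u2 z|.
  move=> c1 i1 m1 c2 i2 m2 x hx.
  apply: (mode_relation_upper _ _ (mode_relationB c1 i1 m1 c2 i2 m2) hx).
    by move=> y; apply: cvgB; [exact: c1 | exact: c2].
  exact: integrable_EFinB.
move=> cD iu Du cD' iu' Du' x hx.
rewrite ler_norml lerNl opprB (upper D u D' u')// andbT.
by under eq_Rintegral do rewrite distrC; exact: upper.
Qed.

End FieldBound.

(** * Norms on sets of finite measure *)

Section L2Norms.
Local Open Scope classical_set_scope.
Variable R : realType.

Context d (U : measurableType d) (mu : {measure set U -> \bar R}).
Variables (A : set U) (m : R).
Hypotheses (mA : measurable A) (muA : mu A = m%:E).

Lemma measure_value_ge0 : 0 <= m.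
Proof. by rewrite -lee_fin -muA measure_ge0. Qed.

(** Cauchy-Schwarz against the indicator function of A. *)
Lemma integral_abs_le_l2norm (u : U -> R) : measurable_fun A u ->
  (\int[mu]_(z in A) `|u z|%:E <= (Num.sqrt m)%:E * l2norm mu A u)%E.
Proof.
move=> mu_u; have m0 := measure_value_ge0.
have mr : measurable_fun [set: U] (u \_ A).
  exact/(measurable_restrictT _ mA).1.
have mi : measurable_fun [set: U] (\1_A : U -> R) by exact: measurable_indic.
have h2 : (2^-1 + 2^-1 = 1 :> R)%R by field.
have := hoelder mu mr mi (ltr0Sn _ _) (ltr0Sn _ _) h2.
have -> : 'N[mu]_2%:E[EFin \o (\1_A : U -> R)]%E = (Num.sqrt m)%:E.
  rewrite unlock (_ : (\int[mu]_x _)%E = m%:E).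
    by rewrite poweR_EFin powR12_sqrt.
  rewrite -muA -[in RHS](setIT A) -integral_indic//.
  apply: eq_integral => z _; rewrite /= indicE normr_nat.
  by case: (_ \in _); rewrite /= ?powR1 ?powR0.
rewrite Lnorm1 muleC; apply: le_trans; rewrite integral_mkcond le_eqVlt.
apply/orP; left; apply/eqP/eq_integral => z _; rewrite /= !patchE indicE.
by case: ifP; rewrite ?mulr1 ?mulr0 ?normr0.
Qed.

Lemma l2norm_le_sup (u : U -> R) (M : R) : measurable_fun A u -> 0 <= M ->
  (forall z, A z -> `|u z| <= M) -> (l2norm mu A u <= (Num.sqrt m * M)%:E)%E.
Proof.
move=> mu_u M0 uM; have m0 := measure_value_ge0.
have -> : (Num.sqrt m * M)%:E = ((m * M ^+ 2)%:E `^ 2^-1)%E.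
  by rewrite poweR_EFin powR12_sqrt ?mulr_ge0 ?sqr_ge0// sqrtrM// sqrtr_sqr ger0_norm.
rewrite /l2norm unlock; apply: gt0_ler_poweR.
- by rewrite invr_ge0.
- by rewrite in_itv /= leey integral_ge0// => z _; exact: poweR_ge0.
- by rewrite in_itv /= leey lee_fin mulr_ge0// sqr_ge0.
apply: (@le_trans _ _ (\int[mu]_(z in A) (M ^+ 2)%:E)%E); last first.
  by rewrite integral_cst// muA -EFinM mulrC.
rewrite [leRHS]integral_mkcond; apply: ge0_le_integral => //.
- by move=> z _; exact: poweR_ge0.
- apply: (measurableT_comp (measurable_poweR _)).
  apply: measurableT_comp => //; apply/measurable_EFinP.
  exact/(measurable_restrictT _ mA).1.
- by apply/(measurable_restrictT _ mA).1; exact: measurable_cst.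
- move=> z _; rewrite /= !patchE; case: ifPn => [/set_mem Az|_].
    rewrite lee_fin -powR_mulrn//.
    by apply: ge0_ler_powR => //; rewrite ?nnegrE ?uM.
  by rewrite normr0 powR0.
Qed.

End L2Norms.

(** * The phase space *)

Section PhaseSpace.
Local Open Scope classical_set_scope.
Variable R : realType.

Variables (vmin vmax : R).
Local Notation O := (Omega vmin vmax).
Hypothesis vlt : vmin < vmax.

Lemma measurable_Omega : measurable (Omega vmin vmax).
Proof. by apply: measurableX; exact: measurable_itv. Qed.

Lemma measure_Omega : leb2 R (Omega vmin vmax) = (2 * pi * (vmax - vmin))%:E.
Proof.
transitivity (leb1 R (@Omega_x R) * leb1 R (Omega_v vmin vmax))%E.
  by apply: product_measure1E; exact: measurable_itv.
rewrite measure_Omega_x.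
have -> : leb1 R (Omega_v vmin vmax) = (if vmin < vmax then vmax - vmin else 0)%:E.
  by have := lebesgue_measure_itv `]vmin, vmax[%R; rewrite /= lte_fin => ->; case: ifP.
by rewrite vlt EFinM.
Qed.

Lemma integrable_tensor (p q : R -> R) : continuous p -> continuous q ->
  (leb2 R).-integrable (Omega vmin vmax) (EFin \o (fun z => p z.1 * q z.2)).
Proof.
move=> cp cq; apply: measurable_bounded_integrable.
- exact: measurable_Omega.
- by rewrite measure_Omega ltry.
- apply: measurable_funTS; apply: measurable_funM.
    exact: (measurableT_comp (continuous_measurable_fun cp) measurable_fst).
  exact: (measurableT_comp (continuous_measurable_fun cq) measurable_snd).
have [B hB] := continuous_bounded_itv (ltW (two_pi_gt0 R)) cp.
have [B' hB'] := continuous_bounded_itv (ltW vlt) cq.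
exists (B * B'); split; first exact: num_real.
move=> M BM [x v] [/=]; rewrite /Omega_x /Omega_v /= !in_itv/= => hx hv.
rewrite normrM; apply: le_trans (ltW BM); apply: ler_pM => //.
  by apply: hB; lra.
by apply: hB'; lra.
Qed.

Lemma l2_integrable (u : _ -> R) : in_l2 (leb2 R) (Omega vmin vmax) u ->
  (leb2 R).-integrable (Omega vmin vmax) (EFin \o u).
Proof.
move=> [mu_u u2]; apply/integrableP; split; first exact/measurable_EFinP.
have := integral_abs_le_l2norm measurable_Omega measure_Omega mu_u.
move/le_lt_trans; apply.
have u0 : (0 <= l2norm (leb2 R) (Omega vmin vmax) u)%E by exact: Lnorm_ge0.
have -> : l2norm (leb2 R) (Omega vmin vmax) u = (fine (l2norm (leb2 R) (Omega vmin vmax) u))%:E.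
  by rewrite fineK// ge0_fin_numE.
by rewrite -EFinM ltry.
Qed.

Lemma integrable_mul_wave (g : R -> R) (u : _ -> R) : continuous g ->
  (forall x, `|g x| <= 1) -> (leb2 R).-integrable O (EFin \o u) ->
  (leb2 R).-integrable O (EFin \o (fun z => u z * g z.1)).
Proof.
move=> cg g1 iu.
apply: (@integrable_EFinM_le1 R _ _ (leb2 R) O u (fun z => g z.1)) => //.
  exact: measurable_Omega.
apply: measurable_funTS.
exact: (measurableT_comp (continuous_measurable_fun cg) measurable_fst).
Qed.

(** Fubini, integrating in x first. *)
Lemma Rintegral_Omega_eq0 (g : R -> R -> R) :
  (leb2 R).-integrable O (EFin \o (fun z => g z.1 z.2)) ->
  (forall v, vmin < v < vmax -> \int[leb1 R]_(x in @Omega_x R) g x v = 0) ->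
  (forall v, vmin < v < vmax ->
     (leb1 R).-integrable (@Omega_x R) (EFin \o (fun x => g x v))) ->
  \int[leb2 R]_(z in O) g z.1 z.2 = 0.
Proof.
move=> ig g0 igx; rewrite /Rintegral integral_mkcond.
have ig' : (leb2 R).-integrable setT ((EFin \o (fun z => g z.1 z.2)) \_ O).
  by apply/integrable_restrict => //; [exact: measurable_Omega | rewrite setTI].
have := integral21_prod_meas1 ig'; rewrite /fubini_G => <-.
rewrite integral0_eq// => v _.
have [hv|hv] := boolP (vmin < v < vmax); last first.
  rewrite integral0_eq// => x _; rewrite patchE memNset// => -[_ /=].
  by rewrite /Omega_v /= in_itv /= (negbTE hv).
have -> : 0%E = (\int[leb1 R]_(x in @Omega_x R) g x v)%:E by rewrite g0.
rewrite /Rintegral fineK; last first.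
  by apply: integrable_fin_num; [exact: measurable_Omega_x | exact: igx].
rewrite [RHS]integral_mkcond; apply: eq_integral => x _.
rewrite !patchE; congr (if _ then _ else _).
by apply/idP/idP; rewrite !inE /Omega /Omega_v /= in_itv/= hv; [case|].
Qed.

End PhaseSpace.

(** * Fourier modes of the exact and of the truncated solution *)

Section Solutions.
Local Open Scope classical_set_scope.
Local Open Scope complex_scope.
Variable R : realType.

Lemma velocity_basis_continuous (vmin vmax : R) phi :
  velocity_basis vmin vmax phi -> forall n, continuous (phi n).
Proof.
move=> [L|[c H]] n.
  have -> : phi n = (fun v => Num.sqrt (n.*2.+1%:R / (vmax - vmin)) *
    (legendre R n).[(2 * v - vmin - vmax) / (vmax - vmin)]).
    by apply/funext => v; exact: L.
  move=> v; apply: cvgM; first exact: cvg_cst.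
  apply: (@continuous_comp R R R (fun v => (2 * v - vmin - vmax) / (vmax - vmin))
     (horner (legendre R n))); last exact: continuous_horner.
  apply: cvgM; last exact: cvg_cst.
  apply: cvgB; last exact: cvg_cst.
  apply: cvgB; last exact: cvg_cst.
  by apply: cvgM; [exact: cvg_cst | exact: cvg_id].
have -> : phi n = (fun v => c n * (hermite R n).[v] * expR (- (v ^+ 2 / 2))).
  by apply/funext => v; have [_] := H n; apply.
move=> v; apply: cvgM.
  by apply: cvgM; [exact: cvg_cst | exact: continuous_horner].
apply: (@continuous_comp R R R (fun v => - (v ^+ 2 / 2)) (@expR R)); last exact: continuous_expR.
apply: cvgN; apply: cvgM; last exact: cvg_cst.
by apply: cvgM; exact: cvg_id.
Qed.

Lemma Re_sum (I : Type) (r : seq I) (F : I -> R[i]) :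
  complex.Re (\sum_(i <- r) F i) = \sum_(i <- r) complex.Re (F i).
Proof. by apply: big_morph => // -[a b] [c d]. Qed.

Lemma sqrt_2pi_gt0 : 0 < Num.sqrt (2 * pi : R).
Proof. by rewrite sqrtr_gt0 two_pi_gt0. Qed.

Lemma Re_mul_eta (c : R[i]) (j : int) (x : R) :
  complex.Re (c * eta j x) =
  complex.Re c / Num.sqrt (2 * pi) * cos (j%:~R * x) +
  - complex.Im c / Num.sqrt (2 * pi) * sin (j%:~R * x).
Proof. by case: c => a b; rewrite /eta /=; ring. Qed.

Lemma space_F_real (NF : nat) (g : R -> R) :
  space_F NF (fun x => (g x)%:C) ->
  exists a b : int -> R, forall x, g x = trig_poly NF a b x.
Proof.
move=> [c gE].
exists (fun j => complex.Re (c j) / Num.sqrt (2 * pi)),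
  (fun j => - complex.Im (c j) / Num.sqrt (2 * pi)) => x.
rewrite -[LHS]/(complex.Re (g x)%:C) gE Re_sum.
by apply: eq_bigr => j _; rewrite Re_mul_eta.
Qed.

(** For fixed v, an element of X^N is a trigonometric polynomial in x of degree
    at most NF; its coefficients depend continuously on v. *)
Lemma space_X_real (vmin vmax : R) (phi : nat -> R -> R) (NS NF : nat)
    (g : R -> R -> R) : (forall n, continuous (phi n)) ->
  space_X vmin vmax phi NS NF (fun z => (g z.1 z.2)%:C) ->
  exists a b : int -> R -> R,
    [/\ forall j, continuous (a j), forall j, continuous (b j) &
    forall x v, vmin <= v <= vmax -> g x v = trig_poly NF (a^~ v) (b^~ v) x].
Proof.
move=> cphi [c gE].
have cont (e : nat -> R) : continuous (fun v => \sum_(n < NS) e n * phi n v).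
  apply: (@continuous_sum_ord R NS (fun n v => e n * phi n v)) => n v.
  by apply: cvgM; [exact: cvg_cst | exact: cphi].
exists (fun j v => \sum_(n < NS) complex.Re (c j n) / Num.sqrt (2 * pi) * phi n v),
  (fun j v => \sum_(n < NS) - complex.Im (c j n) / Num.sqrt (2 * pi) * phi n v).
split=> [j|j|x v hv].
- exact: (cont (fun n => complex.Re (c j n) / Num.sqrt (2 * pi))).
- exact: (cont (fun n => - complex.Im (c j n) / Num.sqrt (2 * pi))).
rewrite -[LHS]/(complex.Re (g x v)%:C) (gE x v hv) Re_sum.
apply: eq_bigr => j _; rewrite Re_sum !mulr_suml -big_split /=.
apply: eq_bigr => n _.
have -> (w : R[i]) (p : R) : complex.Re (w * p%:C) = complex.Re w * p.
  by case: w => a b /=; ring.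
by rewrite Re_mul_eta; ring.
Qed.

(** Orthogonality of the waves of different wave numbers. *)
Lemma trig_poly_modes (g : R -> R) (NF k : nat) (a b : int -> R) (x0 : R) :
  (forall x, g x = trig_poly NF a b x) ->
  (NF < k)%N ->
  \int[leb1 R]_(x in @Omega_x R) (g x * cos (k%:R * (x - x0))) = 0 /\
  \int[leb1 R]_(x in @Omega_x R) (g x * sin (k%:R * (x - x0))) = 0.
Proof.
move=> gE NFk; split.
  rewrite -[RHS](integral_trig_poly_wave a b (- (k%:R * x0)) NFk).
  by apply: eq_Rintegral => x _; rewrite gE mulrBr.
rewrite -[RHS](integral_trig_poly_wave a b (- (k%:R * x0) - pi / 2) NFk).
by apply: eq_Rintegral => x _; rewrite gE sin_as_cos mulrBr addrA.
Qed.

Lemma intr_complex_inv (k : nat) : (k%:Z)%:~R^-1 = (k%:R^-1 : R)%:C.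
Proof. by rewrite -pmulrn -(rmorph_nat (real_complex R)) fmorphV. Qed.

Variables (vmin vmax : R).
Local Notation O := (Omega vmin vmax).

(** Taking real and imaginary parts in E_k = (i / k) f_k gives
    int E cos kx = (1 / k) int f sin kx and
    int E sin kx = - (1 / k) int f cos kx; the addition formulas then shift the
    phase from 0 to x0. *)
Lemma normalized_field_mode (P : pred int) (f : R -> R -> R -> R) (E : R -> R -> R) (t : R)
   (k : nat) (x0 : R) : continuous (E^~ t) ->
  (leb2 R).-integrable O (EFin \o (fun z => f z.1 z.2 t)) ->
  normalized_field vmin vmax P f E t -> (0 < k)%N -> P k%:Z ->
  \int[leb1 R]_(x in @Omega_x R) (E x t * cos (k%:R * (x - x0))) =
  k%:R^-1 * \int[leb2 R]_(z in O) (f z.1 z.2 t * sin (k%:R * (z.1 - x0))).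
Proof.
move=> cE iF [_ /(_ k%:Z)] H k0 Pk; have {H} := H _ Pk.
have -> : k%:Z != 0 by lia.
move=> /(_ isT); rewrite /fourier_coef /cintegral /eta intr_complex_inv /=.
have s0 : Num.sqrt (2 * pi) != 0 :> R by rewrite gt_eqF// sqrt_2pi_gt0.
set s := Num.sqrt _ in s0 *.
have mO := @measurable_Omega R vmin vmax; have mx := @measurable_Omega_x R.
have cC (y : R) := @continuous_dilation _ _ k%:R y (@continuous_cos R).
have cS (y : R) := @continuous_dilation _ _ k%:R y (@continuous_sin R).
have iEc : (leb1 R).-integrable (@Omega_x R) (EFin \o (fun x => E x t * cos (k%:R * (x - 0)))).
  by apply: continuous_integrable_Omega_x => x; apply: cvgM; [exact: cE | exact: cC].
have iEs : (leb1 R).-integrable (@Omega_x R) (EFin \o (fun x => E x t * sin (k%:R * (x - 0)))).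
  by apply: continuous_integrable_Omega_x => x; apply: cvgM; [exact: cE | exact: cS].
have iFc : (leb2 R).-integrable O (EFin \o (fun z => f z.1 z.2 t * cos (k%:R * (z.1 - 0)))).
  apply: (integrable_mul_wave (g := fun x => cos (k%:R * (x - 0)))) => // x.
  exact: cos_max.
have iFs : (leb2 R).-integrable O (EFin \o (fun z => f z.1 z.2 t * sin (k%:R * (z.1 - 0)))).
  apply: (integrable_mul_wave (g := fun x => sin (k%:R * (x - 0)))) => // x.
  exact: sin_max.
have Rc (w y : R) : w * (cos ((- k%:Z)%:~R * y) / s) - 0 * (sin ((- k%:Z)%:~R * y) / s) =
    s^-1 * (w * cos (k%:R * (y - 0))).
  by rewrite mul0r !subr0 mulrNz mulNr cosN pmulrn; ring.
have Ic (w y : R) : w * (sin ((- k%:Z)%:~R * y) / s) + 0 * (cos ((- k%:Z)%:~R * y) / s) =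
    - s^-1 * (w * sin (k%:R * (y - 0))).
  by rewrite mul0r addr0 subr0 mulrNz mulNr sinN pmulrn; ring.
under eq_Rintegral do rewrite Rc.
under [X in _ +i* X = _]eq_Rintegral do rewrite Ic.
under [X in _ = _ * (X +i* _)]eq_Rintegral do rewrite Rc.
under [X in _ = _ * (_ +i* X)]eq_Rintegral do rewrite Ic.
rewrite !RintegralZl//.
set Ec := \int[leb1 R]_(x in @Omega_x R) (E x t * cos (k%:R * (x - 0))).
set Es := \int[leb1 R]_(x in @Omega_x R) (E x t * sin (k%:R * (x - 0))).
set Fc := \int[leb2 R]_(z in O) (f z.1 z.2 t * cos (k%:R * (z.1 - 0))).
set Fs := \int[leb2 R]_(z in O) (f z.1 z.2 t * sin (k%:R * (z.1 - 0))).
have k0' : k%:R != 0 :> R by rewrite pnatr_eq0 -lt0n.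
move=> /= [eRe eIm].
have EcE : Ec = k%:R^-1 * Fs.
  by rewrite -[Ec](mulKf (invr_neq0 s0)) eRe; field; rewrite s0 k0'.
have EsE : Es = - (k%:R^-1 * Fc).
  have -> : Es = - s * (- s^-1 * Es) by field.
  by rewrite eIm; field; rewrite s0 k0'.
(* The phase 0 is kept as y - 0, the form in which [continuous_dilation] and
   the integrals above have it. *)
have cosS (y : R) : cos (k%:R * (y - x0)) =
    cos (k%:R * x0) * cos (k%:R * (y - 0)) + sin (k%:R * x0) * sin (k%:R * (y - 0)).
  by rewrite subr0 mulrBr cosB; ring.
have sinS (y : R) : sin (k%:R * (y - x0)) =
    cos (k%:R * x0) * sin (k%:R * (y - 0)) - sin (k%:R * x0) * cos (k%:R * (y - 0)).
  by rewrite subr0 mulrBr sinB; ring.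
under eq_Rintegral do rewrite cosS mulrDr mulrCA [X in _ + X]mulrCA.
under [in RHS]eq_Rintegral do rewrite sinS mulrBr mulrCA [X in _ - X]mulrCA.
rewrite RintegralD//; [|exact: integrable_EFinZ|exact: integrable_EFinZ].
rewrite RintegralB//; [|exact: integrable_EFinZ|exact: integrable_EFinZ].
rewrite !RintegralZl// -/Ec -/Es -/Fc -/Fs EcE EsE.
by ring.
Qed.

Lemma normalized_field_mean (P : pred int) (f : R -> R -> R -> R) (E : R -> R -> R) (t : R) :
  continuous (E^~ t) ->
  normalized_field vmin vmax P f E t ->
  \int[leb1 R]_(x in @Omega_x R) E x t = 0.
Proof.
move=> cE [+ _]; rewrite /fourier_coef /cintegral /eta /= => -[+ _].
have s0 : Num.sqrt (2 * pi) != 0 :> R by rewrite gt_eqF// sqrt_2pi_gt0.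
set s := Num.sqrt _ in s0 *.
have Rc (w y : R) : w * (cos ((- 0)%:~R * y) / s) - 0 * (sin ((- 0)%:~R * y) / s) = s^-1 * w.
  by rewrite oppr0 !mul0r cos0 subr0 mul1r mulrC.
under eq_Rintegral do rewrite Rc.
rewrite RintegralZl; [|exact: measurable_Omega_x|exact: continuous_integrable_Omega_x].
by move/eqP; rewrite mulf_eq0 invr_eq0 (negbTE s0) => /eqP.
Qed.

Variables (T : R) (phi : nat -> R -> R) (f0 : R -> R -> R).
Hypotheses (vlt : vmin < vmax) (cphi : forall n, continuous (phi n)).
Local Notation related := (mode_relation (leb2 R) O fst).

Lemma exact_modes (f : R -> R -> R -> R) (E : R -> R -> R) (t : R) :
  exact_solution vmin vmax T phi f0 f E -> in_time T t ->
  [/\ continuous (E^~ t),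
      (leb2 R).-integrable O (EFin \o (fun z => f z.1 z.2 t)) &
      related (E^~ t) (fun z => f z.1 z.2 t)].
Proof.
move=> sol ht.
have cE : continuous (E^~ t).
  move=> x; apply: differentiable_continuous; apply/derivable1_diffP.
  exact: (exact_E_derivable sol).
have iF := l2_integrable vlt (exact_f_l2 sol ht).
have nE := exact_normalized sol ht.
split=> //; split=> [|k x0 k0]; first exact: normalized_field_mean nE.
exact: (normalized_field_mode x0 cE iF nE).
Qed.

(** Up to NF the relation is the normalization of E^N; beyond NF it reads
    0 = 0. *)
Lemma truncated_modes (NS NF : nat) (f : R -> R -> R -> R) (E : R -> R -> R) (t : R) :
  truncated_solution vmin vmax T phi NS NF f0 f E -> in_time T t ->
  [/\ continuous (E^~ t),
      (leb2 R).-integrable O (EFin \o (fun z => f z.1 z.2 t)) &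
      related (E^~ t) (fun z => f z.1 z.2 t)].
Proof.
move=> sol ht.
have [a [b EE]] := space_F_real (trunc_E_space sol ht).
have cE : continuous (E^~ t).
  have -> : E^~ t = trig_poly NF a b by apply/funext.
  exact: trig_poly_continuous.
have [p [q [cp cq fE]]] := space_X_real (g := fun x v => f x v t) cphi (trunc_f_space sol ht).
have mO := @measurable_Omega R vmin vmax.
have cC (m : R) := @continuous_dilation _ _ m 0 (@continuous_cos R).
have cS (m : R) := @continuous_dilation _ _ m 0 (@continuous_sin R).
have iF : (leb2 R).-integrable O (EFin \o (fun z => f z.1 z.2 t)).
  apply: (eq_integrable mO (EFin \o (fun z => \sum_(j < (2 * NF).+1)
     (cos ((wave j)%:~R * (z.1 - 0)) * p (wave j) z.2 +
      sin ((wave j)%:~R * (z.1 - 0)) * q (wave j) z.2)))).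
    move=> [x v] /set_mem [_ /=]; rewrite /Omega_v /= in_itv/= => /andP[v1 v2].
    rewrite fE ?ltW//; congr _%:E; apply: eq_bigr => j _.
    by rewrite subr0 [in LHS]mulrC [X in _ + X]mulrC.
  apply: integrable_EFin_sum => // j; apply: integrable_EFinD => //.
    exact: (integrable_tensor vlt (cC _) (cp _)).
  exact: (integrable_tensor vlt (cS _) (cq _)).
have nE := trunc_normalized sol ht.
split=> //; split=> [|k x0 k0]; first exact: normalized_field_mean nE.
have [kNF|NFk] := leqP k NF; first exact: (normalized_field_mode x0 cE iF nE).
rewrite (trig_poly_modes x0 EE NFk).1.
have cs : continuous (fun x : R => sin (k%:R * (x - x0))).
  exact: (continuous_dilation (@continuous_sin R)).
rewrite (@Rintegral_Omega_eq0 R vmin vmax (fun x v => f x v t * sin (k%:R * (x - x0)))).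
- by rewrite mulr0.
- apply: (integrable_mul_wave (g := fun x => sin (k%:R * (x - x0)))) => // x.
  exact: sin_max.
- move=> v /andP[v1 v2].
  apply: (trig_poly_modes (a := p^~ v) (b := q^~ v) x0 _ NFk).2 => x.
  by rewrite fE ?ltW.
- move=> v /andP[v1 v2]; apply: continuous_integrable_Omega_x => x.
  apply: cvgM; last exact: cs.
  have -> : (fun x => f x v t) = trig_poly NF (p^~ v) (q^~ v).
    by apply/funext => y; rewrite fE ?ltW.
  by rewrite fE ?ltW//; exact: trig_poly_continuous.
Qed.

End Solutions.

(** * The estimate *)

Unset Implicit Arguments.

Theorem theorem4p1 (R : realType) :
  exists C : R,
  forall (vmin vmax T : R) (phi : nat -> R -> R)
         (f0 : R -> R -> R) (f : R -> R -> R -> R) (E : R -> R -> R),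
    vmin < vmax -> 0 < T ->
    velocity_basis vmin vmax phi ->
    exact_solution vmin vmax T phi f0 f E ->
  forall (NS NF : nat) (fN : R -> R -> R -> R) (EN : R -> R -> R),
    (0 < NS)%N -> (0 < NF)%N ->
    truncated_solution vmin vmax T phi NS NF f0 fN EN ->
  forall t : R, 0 <= t < T ->
    (l2norm (leb1 R) (@Omega_x R) (fun x => E x t - EN x t)%R <=
     (C * Num.sqrt (vmax - vmin))%R%:E *
     l2norm (leb2 R) (Omega vmin vmax)
       (fun z => f z.1 z.2 t - fN z.1 z.2 t)%R)%E.
Proof.
exists (2 * pi) => vmin vmax T phi f0 f E vlt T0 basis sol NS NF fN EN _ _ solN t ht.
have [cE iF modes] := exact_modes vlt sol ht.
have [cEN iFN modesN] := truncated_modes vlt (velocity_basis_continuous basis) solN ht.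
have mO := @measurable_Omega R vmin vmax; have mx := @measurable_Omega_x R.
set u := (X in (_ * l2norm (leb2 R) _ X)%E).
have iu : (leb2 R).-integrable (Omega vmin vmax) (EFin \o u) by exact: integrable_EFinB.
have mu_u : measurable_fun (Omega vmin vmax) u.
  by apply/measurable_EFinP; have /integrableP[] := iu.
pose M := \int[leb2 R]_(z in Omega vmin vmax) `|u z|.
have cD : continuous (fun x => E x t - EN x t).
  by move=> x; apply: cvgB; [exact: cE | exact: cEN].
have bound x : @Omega_x R x -> `|E x t - EN x t| <= M.
  rewrite /Omega_x /= in_itv/=.
  apply: (norm_bound_left_endpoint cD) => {}x hx.
  apply: (mode_relation_bound _ _ _ cE iF modes cEN iFN modesN hx) => //.
    by apply: measurable_funTS; exact: measurable_fst.
  by move=> [y v] [] /=; rewrite /Omega_x /= in_itv/= => /andP[-> /ltW ->].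
have M0 : 0 <= M by exact: Rintegral_ge0.
apply: (le_trans (l2norm_le_sup mx (measure_Omega_x R) _ M0 bound)).
  by apply: measurable_funTS; exact: continuous_measurable_fun.
have ME : M%:E = (\int[leb2 R]_(z in Omega vmin vmax) `|u z|%:E)%E.
  by rewrite /M /Rintegral fineK//; apply: integrable_fin_num => //; exact: integrable_norm.
rewrite EFinM ME.
apply: (@le_trans _ _ ((Num.sqrt (2 * pi))%:E *
    ((Num.sqrt (2 * pi * (vmax - vmin)))%:E * l2norm (leb2 R) (Omega vmin vmax) u))%E).
  rewrite lee_wpmul2l ?lee_fin ?sqrtr_ge0//.
  exact: (integral_abs_le_l2norm mO (measure_Omega vlt) mu_u).
have tp := ltW (two_pi_gt0 R).
by rewrite muleA -EFinM (sqrtrM (vmax - vmin) tp) mulrA -expr2 sqr_sqrtr.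
Qed.
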